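(* There is an ensemble of encodings $\{D_N\}$, indexed by the binary representations $\langle N\rangle$ of natural numbers $N \geq 1$, such that for every $N$, $D_N : [I_N] \rightarrow \mathrm{QR}(N)$ is an encoding of $\mathrm{QR}(N)$ with $I_N = |\mathrm{QR}(N)|$ (so $D_N$ is an indexing of $\mathrm{QR}(N)$), and the ensemble $\{D_N\}$ is decodable by polynomial size circuits. That is, there is a polynomial $q$ such that for every $N$ there is a Boolean circuit $C_N$ of size at most $q(|\langle N\rangle|)$ that, on input (the binary representation of) any $i \in [I_N]$, outputs (the binary representation of) $D_N(i)$.
   Context: For a natural number $M$, $[M] = \{1,2,\dots,M\}$ (so $[0]=\emptyset$). For a natural number $N$, $\mathbb{Z}_N^* = \{1 \leq x \leq N-1 \mid \gcd(x,N)=1\}$ and $\mathrm{QR}(N) = \{z \in \mathbb{Z}_N^* \mid \exists x \in \mathbb{Z}_N^* \text{ such that } z \equiv x^2 \pmod N\}$ is the set of quadratic residues modulo $N$. An encoding of a finite set $S$ is a function $D : [I] \rightarrow S$ such that for every $s \in S$ there exists $i \in [I]$ with $D(i) = s$ (i.e. a surjection). An indexing is an encoding with $I = |S|$ (hence a bijection). An ensemble of encodings $\{D_x\}$ is an infinite sequence of encodings $D_x$ with domain $[N_x]$, each uniquely identified by a string $x$. The ensemble is decodable by polynomial size circuits if for each $x$ there is a circuit of size $\mathrm{poly}(|x|)$ that computes $D_x(i)$ for every $i \in [N_x]$, where $|x|$ is the length of the string $x$; a different circuit is allowed for each $x$, and the polynomial bound is the same for all $x$. *)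

(* Defs.v *)
From HB Require Import structures.
From mathcomp Require Import all_boot all_order all_algebra finmap.
Set Implicit Arguments.
Unset Strict Implicit.
Unset Printing Implicit Defensive.

Local Open Scope fset_scope.

(* [M] = {1, ..., M}: indices start at 1, unlike 'I_M. *)
Definition bracket (M : nat) : {fset nat} := [fset i in iota 1 M].

(* 1 <= x <= N - 1; in particular Zstar 1 is empty. *)
Definition Zstar (N : nat) : {fset nat} := [fset x in iota 1 N.-1 | coprime x N].

Definition QR (N : nat) : {fset nat} :=
  [fset z in Zstar N | [exists x : Zstar N, z == (val x) ^ 2 %[mod N]]].

Record encoding (S : {fset nat}) := Encoding {
  enc_size : nat;
  decode : bracket enc_size -> S;
  decode_surj : forall s : S, exists i, decode i = s }.

Definition indexing (S : {fset nat}) (D : encoding S) : Prop :=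
  enc_size D = #|` S|.

(* The number of binary digits of m, i.e. the least w with m < 2 ^ w. *)
Definition bit_length (m : nat) : nat := up_log 2 m.+1.

(* The w low-order binary digits of m, least significant first; this is the
   zero-padded binary representation of m as soon as bit_length m <= w. *)
Definition bits (w m : nat) : w.-tuple bool := [tuple odd (m %/ 2 ^ j) | j < w].

Definition binary (m : nat) : bitseq := bits (bit_length m) m.

(* name x is the string that identifies x. X is meant to be infinite (below it
   is posnat), which the record does not impose. *)
Record ensemble (X : Type) (name : X -> bitseq) (S : X -> {fset nat}) :=
  Ensemble {
    name_inj : injective name;
    ens :> forall x, encoding (S x) }.

(* Circuits over the basis {0, 1, NOT, AND, OR} of fan-in at most 2, as
   straight-line programs: on n inputs, wires 0, ..., n - 1 carry the inputs
   and wire n + k carries the value of the k-th gate, whose arguments must be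
   wires of smaller index. Fan-out is unrestricted. *)
Inductive gate :=
  | Const of bool
  | Not of nat
  | And of nat & nat
  | Or of nat & nat.

Definition gate_args (g : gate) : seq nat :=
  match g with
  | Const _ => [::]
  | Not i => [:: i]
  | And i j | Or i j => [:: i; j]
  end.

Definition gate_value (ws : bitseq) (g : gate) : bool :=
  match g with
  | Const b => b
  | Not i => ~~ nth false ws i
  | And i j => nth false ws i && nth false ws j
  | Or i j => nth false ws i || nth false ws j
  end.

Fixpoint wf_gates (n : nat) (gs : seq gate) : bool :=
  if gs is g :: gs' then all (fun i => i < n) (gate_args g) && wf_gates n.+1 gs'
  else true.

Record circuit (n m : nat) := Circuit {
  gates : seq gate;
  outputs : m.-tuple nat;
  gates_wf : wf_gates n gates;
  outputs_wf : all (fun i => i < n + size gates) outputs }.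

Definition circuit_size (n m : nat) (C : circuit n m) : nat := size (gates C).

Definition wires (x : bitseq) (gs : seq gate) : bitseq :=
  foldl (fun ws g => rcons ws (gate_value ws g)) x gs.

Definition circuit_eval (n m : nat) (C : circuit n m) (x : n.-tuple bool) :
    m.-tuple bool :=
  [tuple of [seq nth false (wires x (gates C)) i | i <- outputs C]].

(* A circuit has a fixed number of inputs and of outputs, so indices are padded
   to the length of the largest index, and values to the length of the largest
   element of S: nothing is truncated by bits. *)
Definition in_width (S : {fset nat}) (D : encoding S) : nat :=
  bit_length (enc_size D).

Definition out_width (S : {fset nat}) : nat := bit_length (\max_(s : S) val s).

Definition computes (S : {fset nat}) (D : encoding S)
    (C : circuit (in_width D) (out_width S)) : Prop :=
  forall i : bracket (enc_size D),
    circuit_eval C (bits (in_width D) (val i))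
    = bits (out_width S) (val (decode i)).

Definition decodable_by_poly_size_circuits (X : Type) (name : X -> bitseq)
    (S : X -> {fset nat}) (D : ensemble name S) : Prop :=
  exists q : {poly nat}, forall x : X,
    exists C : circuit (in_width (D x)) (out_width (S x)),
      circuit_size C <= (q.[size (name x)])%R /\ computes C.

Definition posnat := {N : nat | 0 < N}.

(* Main.v *)
(* QR(N) is the group of squares of the units modulo N, hence a direct product
   of cyclic groups <x_1>, ..., <x_k> of orders n_1, ..., n_k. Writing an index
   i < n_1 ... n_k in mixed radix, with digits a_j, and sending it to the product
   of the x_j ^ a_j is a bijection. With the digits a_j themselves in binary, this
   is a greedy procedure over a list, depending only on N, of pairs (c, u) where
   c is a weight n_{j+1} ... n_k 2^t and u = x_j ^ (2^t): whenever c <= i, subtract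
   c from i and multiply the accumulator by u modulo N. The list has length
   O(log N), and since c, u and N can be hardwired, every step reduces to O(log N)
   ripple-carry additions of multiples of constants by a bit. *)

Require Import Defs.
From HB Require Import structures.
From mathcomp Require Import all_boot all_order all_algebra finmap.
From mathcomp Require Import all_fingroup all_solvable zify ring.

Set Implicit Arguments.
Unset Strict Implicit.
Unset Printing Implicit Defensive.

(** * Circuits for arithmetic with constants *)

Lemma size_wires (x : bitseq) gs : size (wires x gs) = size x + size gs.
Proof.
elim: gs x => [|g gs IH] x /=; first by rewrite addn0.
by rewrite /wires /= in IH *; rewrite IH size_rcons addSnnS.
Qed.

Lemma wires_rcons x gs g :
  wires x (rcons gs g) = rcons (wires x gs) (gate_value (wires x gs) g).
Proof. by rewrite /wires foldl_rcons. Qed.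

Lemma wf_gates_rcons n gs g :
  wf_gates n (rcons gs g) =
  wf_gates n gs && all (fun i => i < n + size gs) (gate_args g).
Proof.
elim: gs n => [|h gs IH] n /=; first by rewrite addn0 andbT.
by rewrite IH addSnnS andbA.
Qed.

Lemma odd_divn_exp2_small m j w : m < 2 ^ w -> w <= j -> odd (m %/ 2 ^ j) = false.
Proof.
by move=> mw wj; rewrite divn_small //; apply: leq_trans mw _; rewrite leq_exp2l.
Qed.

Lemma modn_exp2S m j : m %% 2 ^ j.+1 = m %% 2 ^ j + odd (m %/ 2 ^ j) * 2 ^ j.
Proof.
have p0 : 0 < 2 ^ j by rewrite expn_gt0.
rewrite {1}(divn_eq m (2 ^ j)) {1}(divn_eq (m %/ 2 ^ j) 2) modn2.
have -> : (m %/ 2 ^ j %/ 2 * 2 + odd (m %/ 2 ^ j)) * 2 ^ j + m %% 2 ^ j =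
  (m %/ 2 ^ j %/ 2) * 2 ^ j.+1 + (m %% 2 ^ j + odd (m %/ 2 ^ j) * 2 ^ j).
  by rewrite expnS; ring.
rewrite modnMDl modn_small // expnS.
by have := ltn_pmod m p0; case: (odd _); lia.
Qed.

Section Availability.

(* The inputs are the words [inp a], so that what a circuit computes is a
   function of [a]. *)
Variables (A : Type) (n : nat) (inp : A -> n.-tuple bool).

Definition program := {gs : seq gate | wf_gates n gs}.

Implicit Types (gs : program) (F G : A -> nat) (f g b : A -> bool).

(** The wire number stays existential, so that constructions compose without index bookkeeping. *)
Definition avail gs f :=
  exists2 i, i < n + size (sval gs)
           & forall a, nth false (wires (inp a) (sval gs)) i = f a.

(** Only digits below [w] are constrained: a register holds [F] modulo [2 ^ w], on wires that may be
    scattered or shared. *)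
Definition reg gs w F := forall j, j < w -> avail gs (fun a => odd (F a %/ 2 ^ j)).

Definition extends k gs gs' :=
  size (sval gs') <= k + size (sval gs) /\ forall f, avail gs f -> avail gs' f.

Lemma eq_avail gs f g : f =1 g -> avail gs f -> avail gs g.
Proof. by move=> fg [i ilt fi]; exists i => // a; rewrite fi fg. Qed.

(** For [j < w], [2 ^ w] is an even multiple of [2 ^ j], so digit [j] depends only on the residue
    modulo [2 ^ w]. *)
Lemma reg_eqmod gs w F G :
  (forall a, F a = G a %[mod 2 ^ w]) -> reg gs w F -> reg gs w G.
Proof.
move=> FG rF j jw; apply: eq_avail (rF j jw) => a.
have E m : odd (m %/ 2 ^ j) = odd (m %% 2 ^ w %/ 2 ^ j).
  have D : 2 ^ w = 2 ^ (w - j.+1) * 2 * 2 ^ j.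
    by rewrite -mulnA -expnS -expnD subnK.
  rewrite {1}(divn_eq m (2 ^ w)) {2}D !mulnA.
  by rewrite divnMDl ?expn_gt0 // oddD oddM andbF.
by rewrite E FG -E.
Qed.

Lemma eq_reg gs w F G : F =1 G -> reg gs w F -> reg gs w G.
Proof. by move=> FG; apply: reg_eqmod => a; rewrite FG. Qed.

Lemma extends_avail k gs gs' f : extends k gs gs' -> avail gs f -> avail gs' f.
Proof. by case=> _; apply. Qed.

Lemma extends_reg k gs gs' w F : extends k gs gs' -> reg gs w F -> reg gs' w F.
Proof. by move=> [_ e] r j jw; apply/e/r. Qed.

Lemma extends_trans k l gs1 gs2 gs3 :
  extends k gs1 gs2 -> extends l gs2 gs3 -> extends (k + l) gs1 gs3.
Proof. by move=> [s12 e12] [s23 e23]; split=> [|f /e12/e23//]; lia. Qed.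

Lemma extends_le k l gs gs' : k <= l -> extends k gs gs' -> extends l gs gs'.
Proof. by move=> kl [s e]; split=> //; lia. Qed.

Lemma avail_gate gs (h : gate) :
  all (fun i => i < n + size (sval gs)) (gate_args h) ->
  exists gs', extends 1 gs gs' /\
    avail gs' (fun a => gate_value (wires (inp a) (sval gs)) h).
Proof.
move=> args.
have wf : wf_gates n (rcons (sval gs) h) by rewrite wf_gates_rcons args (svalP gs).
exists (exist (fun s : seq gate => wf_gates n s) _ wf); split; first split=> [|f [i ilt fi]] /=.
- by rewrite size_rcons.
- exists i => [|a] /=; first by rewrite size_rcons; lia.
  by rewrite wires_rcons nth_rcons size_wires size_tuple ilt fi.
- exists (n + size (sval gs)) => [|a] /=; first by rewrite size_rcons; lia.
  by rewrite wires_rcons nth_rcons size_wires size_tuple ltnn eqxx.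
Qed.

Lemma avail_const gs c : exists gs', extends 1 gs gs' /\ avail gs' (fun=> c).
Proof. exact: (@avail_gate gs (Const c)). Qed.

Lemma avail_not gs f : avail gs f ->
  exists gs', extends 1 gs gs' /\ avail gs' (fun a => ~~ f a).
Proof.
move=> [i ilt fi].
have [|gs' [e av]] := @avail_gate gs (Not i); first by rewrite /= ilt.
by exists gs'; split=> //; apply: eq_avail av => a /=; rewrite fi.
Qed.

Lemma avail_and gs f g : avail gs f -> avail gs g ->
  exists gs', extends 1 gs gs' /\ avail gs' (fun a => f a && g a).
Proof.
move=> [i ilt fi] [j jlt gj].
have [|gs' [e av]] := @avail_gate gs (And i j); first by rewrite /= ilt jlt.
by exists gs'; split=> //; apply: eq_avail av => a /=; rewrite fi gj.
Qed.

Lemma avail_or gs f g : avail gs f -> avail gs g ->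
  exists gs', extends 1 gs gs' /\ avail gs' (fun a => f a || g a).
Proof.
move=> [i ilt fi] [j jlt gj].
have [|gs' [e av]] := @avail_gate gs (Or i j); first by rewrite /= ilt jlt.
by exists gs'; split=> //; apply: eq_avail av => a /=; rewrite fi gj.
Qed.

Lemma avail_xor gs f g : avail gs f -> avail gs g ->
  exists gs', extends 4 gs gs' /\ avail gs' (fun a => f a (+) g a).
Proof.
move=> af ag.
have [gs1 [e1 o]] := avail_or af ag.
have [gs2 [e2 c]] := avail_and (extends_avail e1 af) (extends_avail e1 ag).
have [gs3 [e3 nc]] := avail_not c.
have [gs4 [e4 r]] := avail_and (extends_avail e3 (extends_avail e2 o)) nc.
exists gs4; split.
  exact: extends_trans (extends_trans (extends_trans e1 e2) e3) e4.
by apply: eq_avail r => a; case: (f a); case: (g a).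
Qed.

Lemma avail_maj gs f g b : avail gs f -> avail gs g -> avail gs b ->
  exists gs', extends 4 gs gs' /\
    avail gs' (fun a => f a && g a || b a && (f a || g a)).
Proof.
move=> af ag ab.
have [gs1 [e1 o]] := avail_or af ag.
have [gs2 [e2 c]] := avail_and (extends_avail e1 af) (extends_avail e1 ag).
have e12 := extends_trans e1 e2.
have [gs3 [e3 d]] := avail_and (extends_avail e12 ab) (extends_avail e2 o).
have [gs4 [e4 r]] := avail_or (extends_avail e3 c) d.
by exists gs4; split=> //; apply: extends_trans (extends_trans e12 e3) e4.
Qed.

(* [2 ^ w <= F a %% 2 ^ w + G a %% 2 ^ w] is the carry out of position [w - 1]. *)
Lemma reg_add gs w F G : reg gs w F -> reg gs w G ->
  exists gs', [/\ extends (12 * w + 1) gs gs', reg gs' w (fun a => F a + G a)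
    & avail gs' (fun a => 2 ^ w <= F a %% 2 ^ w + G a %% 2 ^ w)].
Proof.
elim: w => [|w IH] rF rG.
  have [gs' [e av]] := avail_const gs false.
  exists gs'; split=> //; apply: eq_avail av => a.
  by rewrite !modn1.
have [||gs1 [e1 r1 c1]] := IH.
- by move=> j jw; apply: rF; apply: ltnW.
- by move=> j jw; apply: rG; apply: ltnW.
have f1 := extends_avail e1 (rF w (ltnSn w)).
have g1 := extends_avail e1 (rG w (ltnSn w)).
have [gs2 [e2 x2]] := avail_xor f1 g1.
have [gs3 [e3 x3]] := avail_xor x2 (extends_avail e2 c1).
have e23 := extends_trans e2 e3.
have [gs4 [e4 m4]] := avail_maj (extends_avail e23 f1) (extends_avail e23 g1)
  (extends_avail e23 c1).
exists gs4; split.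
- by apply: extends_le (extends_trans (extends_trans e1 e23) e4); lia.
- move=> j; rewrite ltnS leq_eqVlt => /predU1P [->|jw].
    apply: eq_avail (extends_avail e4 x3) => a.
    (* The last term of [divnD] is the carry out of the lower digits, available by induction. *)
    by rewrite divnD ?expn_gt0 // !oddD; case: (_ <= _).
  exact: extends_avail e4 (extends_avail e23 (r1 j jw)).
- apply: eq_avail m4 => a; rewrite !modn_exp2S expnS.
  have := @ltn_pmod (F a) (2 ^ w); have := @ltn_pmod (G a) (2 ^ w).
  rewrite expn_gt0 /=; move: (2 ^ w) (F a %% 2 ^ w) (G a %% 2 ^ w) => p u v up vp.
  by case: (odd _); case: (odd _); apply/idP/idP => /=; lia.
Qed.

(** As [v] is a constant, each digit of the product is either [b] itself or false, so one constant
    wire serves every width. *)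
Lemma reg_scale gs b v : avail gs b ->
  exists gs', extends 1 gs gs' /\ forall w, reg gs' w (fun a => b a * v).
Proof.
move=> ab; have [gs' [e av]] := avail_const gs false.
exists gs'; split=> // w j _; case vj : (odd (v %/ 2 ^ j)).
  by apply: eq_avail (extends_avail e ab) => a; case: (b a); rewrite ?mul1n ?div0n ?vj.
by apply: eq_avail av => a; case: (b a); rewrite ?mul1n ?div0n ?vj.
Qed.

(** The comparison is the carry out of adding [2 ^ w - c] to [F]; [0 < c] makes this addend fit in
    [w] digits. *)
Lemma avail_geq gs w F c : reg gs w F -> (forall a, F a < 2 ^ w) ->
  0 < c <= 2 ^ w ->
  exists gs', extends (12 * w + 3) gs gs' /\ avail gs' (fun a => c <= F a).
Proof.
move=> rF Fw /andP [c0 cw].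
have [gs1 [e1 t]] := avail_const gs true.
have [gs2 [e2 s]] := reg_scale (2 ^ w - c) t.
have e12 := extends_trans e1 e2.
have [gs3 [e3 _ r]] := reg_add (extends_reg e12 rF) (s w).
exists gs3; split; first by apply: extends_le (extends_trans e12 e3); lia.
apply: eq_avail r => a /=; rewrite mul1n !modn_small //; last lia.
by apply/idP/idP; lia.
Qed.

(* Subtracting [c] is adding [2 ^ w - c] modulo [2 ^ w]. *)
Lemma reg_condsub gs w F b c : reg gs w F -> avail gs b -> c <= 2 ^ w ->
  (forall a, b a -> c <= F a) ->
  exists gs', extends (12 * w + 2) gs gs' /\ reg gs' w (fun a => F a - b a * c).
Proof.
move=> rF ab cw bF.
have [gs1 [e1 s]] := reg_scale (2 ^ w - c) ab.
have [gs2 [e2 r _]] := reg_add (extends_reg e1 rF) (s w).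
exists gs2; split; first by apply: extends_le (extends_trans e1 e2); lia.
apply: reg_eqmod r => a; case ba : (b a); rewrite ?mul0n ?addn0 ?subn0 // !mul1n.
have -> : F a + (2 ^ w - c) = F a - c + 2 ^ w by have := bF a ba; lia.
by rewrite modnDr.
Qed.

(** The sum is below [2 N], so it does not overflow and one conditional subtraction of [N] reduces
    it. *)
Lemma reg_modadd gs w N S b v : reg gs w S -> avail gs b -> (forall a, S a < N) ->
  v < N -> N.*2 <= 2 ^ w ->
  exists gs', extends (36 * w + 7) gs gs' /\
    reg gs' w (fun a => (S a + b a * v) %% N).
Proof.
move=> rS ab SN vN Nw.
have [gs1 [e1 s]] := reg_scale v ab.
have [gs2 [e2 t _]] := reg_add (extends_reg e1 rS) (s w).
have tlt a : S a + b a * v < N.*2 by have := SN a; case: (b a); lia.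
have [|| gs3 [e3 g]] := avail_geq (c := N) t.
- by move=> a; apply: leq_trans Nw.
- by lia.
have [||gs4 [e4 r]] := reg_condsub (c := N) (extends_reg e3 t) g.
- by lia.
- by [].
exists gs4; split.
  by apply: extends_le (extends_trans (extends_trans (extends_trans e1 e2) e3) e4); lia.
apply: eq_reg r => a; have [le|lt] := leqP N (S a + b a * v).
  rewrite -[in RHS](subnK le) modnDr modn_small ?mul1n //; have := tlt a; lia.
by rewrite modn_small // subn0.
Qed.

(** For a bit [b], [u ^ b = 1 + b (u - 1)]. The product is thus [S] plus, for each digit [t] of [S],
    the constant [2 ^ t (u - 1)] modulo [N], added when both that digit and [b] are set. *)
Lemma reg_modmul gs w N S b u : reg gs w S -> avail gs b -> (forall a, S a < N) ->
  0 < N -> N.*2 <= 2 ^ w ->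
  exists gs', extends (w * (36 * w + 8)) gs gs' /\
    reg gs' w (fun a => (S a * u ^ b a) %% N).
Proof.
(* [v] represents [u - 1] modulo [N], also when [u = 0]. *)
move=> rS ab SN N0 Nw; set v := u + N.-1.
(* [t] counts the digits of [S] already processed; at [t = w] they make up all of [S], since
   [S a < N <= 2 ^ w]. *)
suff P t : t <= w -> exists gs', extends (t * (36 * w + 8)) gs gs' /\
    reg gs' w (fun a => (S a + b a * (S a %% 2 ^ t) * v) %% N).
  have [gs' [e r]] := P w (leqnn w); exists gs'; split=> //; apply: eq_reg r => a.
  rewrite (@modn_small (S a)); last by have := SN a; lia.
  case: (b a); rewrite ?mul1n ?mul0n ?addn0 ?muln1 // expn1.
  rewrite /v; have -> : S a + S a * (u + N.-1) = S a * u + S a * N by nia.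
  by rewrite addnC modnMDl.
elim: t => [|t IH] tw.
  exists gs; split=> //; apply: eq_reg rS => a.
  by rewrite modn1 muln0 addn0 modn_small.
have [gs1 [e1 r1]] := IH (ltnW tw).
have [gs2 [e2 c]] := avail_and (extends_avail e1 ab) (extends_avail e1 (rS t tw)).
have [|||gs3 [e3 r3]] := reg_modadd (N := N) (v := (2 ^ t * v) %% N)
  (extends_reg e2 r1) c.
- by move=> a; rewrite ltn_mod.
- by rewrite ltn_mod.
- by [].
exists gs3; split; first by apply: extends_le (extends_trans (extends_trans e1 e2) e3); lia.
apply: eq_reg r3 => a; rewrite modnDml modn_exp2S.
rewrite -modnDmr modnMmr modnDmr; congr (_ %% _).
by case: (b a); case: (odd _) => /=; ring.
Qed.

End Availability.

(** * Circuits for the greedy procedure *)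

Fixpoint greedy (T : Type) (op : T -> T -> T) (L : seq (nat * T)) r s : T :=
  if L is (c, u) :: L' then
    if c <= r then greedy op L' (r - c) (op s u) else greedy op L' r s
  else s.

Definition mulmod N x y := (x * y) %% N.

Lemma reg_greedy A n (inp : A -> n.-tuple bool) gs w N L (R S : A -> nat) :
  reg inp gs w R -> reg inp gs w S -> (forall a, R a < 2 ^ w) ->
  (forall a, S a < N) -> 0 < N -> N.*2 <= 2 ^ w ->
  all (fun p => 0 < p.1 <= 2 ^ w) L ->
  exists gs', extends inp (size L * (36 * w ^ 2 + 32 * w + 5)) gs gs' /\
    reg inp gs' w (fun a => greedy (mulmod N) L (R a) (S a)).
Proof.
move=> rR rS Rw SN N0 Nw.
elim: L gs R S rR rS Rw SN => [|[c u] L IH] gs R S rR rS Rw SN /=.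
  by move=> _; exists gs.
case/andP=> cw Lw; have /andP [_ cw'] := cw.
have [gs1 [e1 b]] := avail_geq rR Rw cw.
have [|gs2 [e2 r2]] := reg_condsub (c := c) (extends_reg e1 rR) b cw'; first by [].
have e12 := extends_trans e1 e2.
have [gs3 [e3 r3]] := reg_modmul u (extends_reg e12 rS) (extends_avail e2 b) SN N0 Nw.
have [||gs4 [e4 r4]] := IH _ _ _ (extends_reg e3 r2) r3 _ _ Lw.
- by move=> a; apply: leq_ltn_trans (Rw a); apply: leq_subr.
- by move=> a; rewrite ltn_mod.
exists gs4; split.
  apply: extends_le (extends_trans (extends_trans e12 e3) e4).
  by apply/eq_leq; ring.
(* When the test fails, both controlled updates are trivial, the modular one because [S a < N]. *)
apply: eq_reg r4 => a; case: leqP => _.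
  by rewrite mul1n expn1.
by rewrite mul0n subn0 expn0 muln1 modn_small.
Qed.

Lemma ltn_exp2_bit_length m : m < 2 ^ bit_length m.
Proof. exact: up_logP. Qed.

Lemma bit_length_leq m w : m < 2 ^ w -> bit_length m <= w.
Proof. exact: up_log_min. Qed.

Lemma mem_bracket M i : (i \in bracket M) = (0 < i <= M).
Proof. by rewrite in_fset /= mem_iota; lia. Qed.

Lemma greedy_circuit (S : {fset nat}) (D : encoding S) w N L :
  0 < N -> N.*2 <= 2 ^ w -> enc_size D < 2 ^ w -> (forall s, s \in S -> s < N) ->
  all (fun p => 0 < p.1 <= 2 ^ w) L ->
  (forall i : bracket (enc_size D), val (decode i) = greedy (mulmod N) L (val i) (1 %% N)) ->
  exists C : circuit (in_width D) (out_width S),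
    circuit_size C <= size L * (36 * w ^ 2 + 32 * w + 5) + 3 /\ computes C.
Proof.
move=> N0 Nw Dw SN Lw DE.
pose inp (a : bracket (enc_size D)) := bits (in_width D) (val a).
have aD (a : bracket (enc_size D)) : val a <= enc_size D.
  by have := fsvalP a; rewrite mem_bracket => /andP [].
pose gs0 : program (in_width D) := exist (fun s : seq gate => wf_gates _ s) [::] isT.
(* This wire pads the index from its input width to [w] digits. *)
have [gs1 [e1 f1]] := avail_const inp gs0 false.
have r1 : reg inp gs1 w (fun a => val a).
  move=> j _; have [jn|nj] := ltnP j (in_width D).
    apply: extends_avail e1 _; exists j => [|a]; first by rewrite addn0.
    by rewrite -(tnth_nth false (inp a) (Ordinal jn)) tnth_mktuple.
  apply: eq_avail f1 => a; rewrite (odd_divn_exp2_small _ nj) //.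
  exact: leq_ltn_trans (aD a) (ltn_exp2_bit_length _).
(* The initial accumulator is a true bit times the constant [1 %% N], which stays below [N] even for
   [N = 1]. *)
have [gs2 [e2 t2]] := avail_const inp gs1 true.
have [gs3 [e3 s3]] := reg_scale (1 %% N) t2.
have [||gs4 [e4 r4]] := reg_greedy (extends_reg (extends_trans e2 e3) r1)
  (s3 w) _ _ N0 Nw Lw.
- by move=> a; apply: leq_ltn_trans (aD a) Dw.
- by move=> a; rewrite mul1n ltn_mod.
have ow : out_width S <= w.
  apply/bit_length_leq/(@leq_ltn_trans N.-1); last lia.
  by apply/bigmax_leqP => s _; have := SN _ (valP s); case: (N) N0.
have [|f fP] := @fin_all_exists 'I_(out_width S) (fun=> nat) (fun j i =>
    i < in_width D + size (sval gs4) /\ forall a, nth false (wires (inp a) (sval gs4)) i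
      = odd (val (decode a) %/ 2 ^ j)).
  move=> j; have [i ilt iP] := r4 j (leq_trans (ltn_ord j) ow).
  by exists i; split=> // a; rewrite iP DE mul1n.
have wf : all (fun i => i < in_width D + size (sval gs4)) [tuple f j | j < out_width S].
  by apply/all_tnthP => j; rewrite tnth_mktuple; case: (fP j).
exists (Circuit (svalP gs4) wf); split.
  by have [] := extends_trans (extends_trans (extends_trans e1 e2) e3) e4; rewrite /circuit_size /=; lia.
move=> a; apply: eq_from_tnth => j.
by rewrite tnth_map !tnth_mktuple; have [_ ->] := fP j.
Qed.

(** * Mixed radix enumeration of a finite abelian group *)

Section MixedRadix.

Variable gT : finGroupType.
Implicit Types (G : {group gT}) (L : seq (nat * gT)) (b : seq gT).
Local Open Scope group_scope.

Lemma greedy_in_group G L r s :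
  all (fun p => p.2 \in G) L -> s \in G -> greedy mulg L r s \in G.
Proof.
elim: L r s => [|[c u] L IH] r s //= /andP [uG LG] sG.
by case: ifP => _; apply: IH => //; apply: groupM.
Qed.

Fixpoint binary_powers W (x : gT) T : seq (nat * gT) :=
  if T is T'.+1 then ((W * 2 ^ T')%N, x ^+ (2 ^ T')) :: binary_powers W x T'
  else [::].

Lemma size_binary_powers W x T : size (binary_powers W x T) = T.
Proof. by elim: T => //= T ->. Qed.

Lemma binary_powers_weight W x T : 0 < W ->
  all (fun p => 0 < p.1 <= W * 2 ^ T.-1) (binary_powers W x T).
Proof.
move=> W0; elim: T => //= T IH; rewrite muln_gt0 W0 expn_gt0 leqnn /=.
apply: sub_all IH => p /andP [-> le]; apply: leq_trans le _.
by rewrite leq_mul2l leq_exp2l // leq_pred orbT.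
Qed.

Lemma binary_powers_group G W x T :
  x \in G -> all (fun p => p.2 \in G) (binary_powers W x T).
Proof. by move=> xG; elim: T => //= T ->; rewrite groupX. Qed.

(** Since [r < W], the test [W * 2 ^ t <= a * W + r] amounts to [2 ^ t <= a]: the block reads off
    the binary digits of [a] from the top and leaves [r]. *)
Lemma greedy_binary_powers W x T L a r s : a < 2 ^ T -> r < W ->
  greedy mulg (binary_powers W x T ++ L) (a * W + r) s =
  greedy mulg L r (s * x ^+ a).
Proof.
elim: T a s => [|T IH] a s aT rW.
  have -> : a = 0%N by case: a aT.
  by rewrite mul0n add0n expg0 mulg1.
rewrite expnS in aT; rewrite /=; have [le|lt] := leqP (2 ^ T) a.
  have -> : (W * 2 ^ T <= a * W + r)%N by nia.
  have -> : (a * W + r - W * 2 ^ T = (a - 2 ^ T) * W + r)%N by nia.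
  by rewrite IH // -?mulgA -?expgD ?subnKC //; lia.
have -> : (W * 2 ^ T <= a * W + r)%N = false by nia.
exact: IH.
Qed.

(** The head of [b] gets the most significant digit; [up_log 2 #[x]] bits hold every exponent below
    [#[x]]. *)
Fixpoint mixed_radix b : seq (nat * gT) :=
  if b is x :: b' then
    binary_powers (\prod_(y <- b') #[y])%N x (up_log 2 #[x]) ++ mixed_radix b'
  else [::].

Lemma prod_order_gt0 b : 0 < (\prod_(y <- b) #[y])%N.
Proof. by apply: prodn_gt0 => y; apply: order_gt0. Qed.

Lemma mixed_radix_weight b :
  all (fun p => 0 < p.1 <= (\prod_(y <- b) #[y])%N) (mixed_radix b).
Proof.
elim: b => //= x b IH; rewrite big_cons all_cat; set W := \big[_/_]_(_ <- _) _.
have W0 : 0 < W := prod_order_gt0 b; apply/andP; split.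
  (* A trivial factor contributes no pairs; it is set apart because [up_log_gtn] needs an order
     above 1. *)
  have [x1|x1] := leqP #[x] 1.
    have -> : up_log 2 #[x] = 0%N by apply/eqP; rewrite up_log_eq0 x1.
    by [].
  apply: sub_all (binary_powers_weight x _ W0) => p /andP [-> le].
  apply: leq_trans le _; rewrite mulnC leq_mul2r ltnW ?orbT //.
  exact: up_log_gtn.
apply: sub_all IH => p /andP [-> le]; apply: leq_trans le _.
exact: leq_pmull (order_gt0 x).
Qed.

(** A factor of order [m > 1] contributes [T] pairs with [2 ^ T.-1 < m], hence [2 ^ T <= m ^ 2]. The
    total length is at most twice the binary logarithm of the product of the orders. *)
Lemma size_mixed_radix b :
  2 ^ size (mixed_radix b) <= (\prod_(y <- b) #[y])%N ^ 2.
Proof.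
elim: b => [|x b IH] /=; first by rewrite big_nil.
rewrite big_cons size_cat size_binary_powers expnD expnMn leq_mul //.
have [x1|x1] := leqP #[x] 1.
  have -> : up_log 2 #[x] = 0%N by apply/eqP; rewrite up_log_eq0 x1.
  by rewrite expn_gt0 order_gt0.
have := up_log_gtn (isT : 1 < 2) x1; have : 0 < up_log 2 #[x] by rewrite up_log_gt0 x1.
by case: (up_log _ _) => //= t _; rewrite expnS; nia.
Qed.

Lemma mixed_radix_group b G : \big[dprod/1]_(x <- b) <[x]> = G ->
  all (fun p => p.2 \in G) (mixed_radix b).
Proof.
elim: b G => //= x b IH G; rewrite big_cons all_cat => dG.
have [[_ H _ defH] KH _ _] := dprodP dG; rewrite defH in KH; apply/andP; split.
  apply: binary_powers_group; rewrite -KH.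
  by apply: (subsetP (mulG_subl _ _)); apply: cycle_id.
apply: sub_all (IH H defH) => p pH.
by rewrite -KH; apply: (subsetP (mulG_subr _ _)).
Qed.

Lemma greedy_mixed_radix b G z : \big[dprod/1]_(x <- b) <[x]> = G -> z \in G ->
  exists2 i, i < (\prod_(y <- b) #[y])%N
           & forall s, greedy mulg (mixed_radix b) i s = s * z.
Proof.
elim: b G z => [|x b IH] G z /=.
  rewrite !big_nil => <- /set1P ->; exists 0%N => // s.
  by rewrite mulg1.
rewrite !big_cons => dG zG.
have [y [h [yx hH -> _]]] := mem_dprod dG zG.
have [[_ H _ defH] _ _ _] := dprodP dG.
rewrite defH in hH; have [r rW rE] := IH H h defH hH.
have [a ax ->] := cyclePmin yx.
(* The leading digit is the exponent of [x] in the cyclic component of [z]; [r] encodes the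
   component in the remaining factors. *)
exists (a * \prod_(j <- b) #[j] + r)%N.
  by move: ax rW; move: (\prod_(j <- b) _)%N => W; nia.
move=> s; rewrite greedy_binary_powers //.
  by rewrite rE mulgA.
exact: leq_trans ax (up_logP _ _).
Qed.

(** The structure theorem supplies cyclic factors whose orders multiply to [#|G|], so exactly [#|G|]
    indices cover [G]. [L] is given as data, so that an encoding can be defined from it. *)
Lemma abelian_greedy G : abelian G ->
  {L | [/\ all (fun p => 0 < p.1 <= #|G|) L, all (fun p => p.2 \in G) L,
           2 ^ size L <= #|G| ^ 2
         & forall z, z \in G -> exists2 i, i < #|G| & greedy mulg L i 1 = z]}.
Proof.
move=> /abelian_structure [b dG _]; exists (mixed_radix b).
rewrite -(bigdprod_card dG); split.
- exact: mixed_radix_weight.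
- exact: mixed_radix_group.
- exact: size_mixed_radix.
- by move=> z /(greedy_mixed_radix dG) [i ib iz]; exists i; rewrite ?iz ?mul1g.
Qed.

End MixedRadix.

(** * Quadratic residues as a group of squares *)

Section Squares.

Variable n : nat.
(** ['Z_N] is the ring of integers modulo [N] only from 2 on. *)
Let N := n.+2.
Local Open Scope group_scope.

Definition squares := [set u ^+ 2 | u : {unit 'Z_N}].

Lemma units_mulgC (u v : {unit 'Z_N}) : commute u v.
Proof. by apply: val_inj; rewrite /= GRing.mulrC. Qed.

Lemma squares_group_set : group_set squares.
Proof.
apply/group_setP; split; first by apply/imsetP; exists 1; rewrite ?expg1n.
move=> _ _ /imsetP [u _ ->] /imsetP [v _ ->]; apply/imsetP; exists (u * v) => //.
by rewrite expgMn //; apply: units_mulgC.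
Qed.

Canonical squares_group := Group squares_group_set.

Lemma squares_abelian : abelian squares.
Proof. by apply/centsP => u _ v _; apply: units_mulgC. Qed.

Definition unit_repr (u : {unit 'Z_N}) : nat := val (val u : 'Z_N).

Lemma unit_repr_inj : injective unit_repr.
Proof. by move=> u v uv; apply/val_inj/val_inj. Qed.

Lemma unit_reprM u v : unit_repr (u * v) = mulmod N (unit_repr u) (unit_repr v).
Proof. by []. Qed.

(** The tests involve only weights and the index, so the runs in the group and on residues take the
    same branches. *)
Lemma greedy_unit_repr L r s :
  unit_repr (greedy mulg L r s) =
  greedy (mulmod N) [seq (p.1, unit_repr p.2) | p <- L] r (unit_repr s).
Proof.
elim: L r s => [|[c u] L IH] r s //=.
by case: ifP => _; rewrite IH ?unit_reprM.
Qed.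

Lemma mem_Zstar z : (z \in Zstar N) = (0 < z < N) && coprime z N.
Proof. by rewrite in_fset inE; congr (_ && _); apply: mem_iota. Qed.

Lemma unit_repr_Zstar u : unit_repr u \in Zstar N.
Proof.
rewrite mem_Zstar.
have cop : coprime (unit_repr u) N.
  by rewrite coprime_sym -unitZpE // natr_Zp; apply: valP u.
rewrite cop ltn_ord !andbT lt0n; apply: contraTneq cop => ->.
by rewrite /coprime gcd0n.
Qed.

Lemma Zstar_unit_repr x : x \in Zstar N -> exists u, x = unit_repr u.
Proof.
rewrite mem_Zstar => /andP [/andP [_ xN] cop].
have xu : (x%:R : 'Z_N)%R \is a GRing.unit by rewrite unitZpE // coprime_sym.
by exists (FinRing.unit 'Z_N xu); rewrite /unit_repr /= val_Zp_nat // modn_small.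
Qed.

(** Both sides consist of least residues: [z < N] turns the congruence with a square into an
    equality. *)
Lemma QR_squares : QR N = [fset unit_repr u | u in squares]%fset.
Proof.
apply/fsetP => z; rewrite in_fset /= inE /=; apply/andP/imfsetP => /=.
  case=> zZ /existsP [x /eqP zx].
  have [u xu] := Zstar_unit_repr (fsvalP x).
  exists (u ^+ 2); first exact: imset_f.
  rewrite expgS expg1 unit_reprM -xu /mulmod mulnn -zx modn_small //.
  by move: zZ; rewrite mem_Zstar => /andP [/andP []].
case=> _ /imsetP [u _ ->] ->; split; first exact: unit_repr_Zstar.
apply/existsP; exists [` unit_repr_Zstar u]%fset => /=.
by rewrite expgS expg1 unit_reprM /mulmod modn_mod mulnn.
Qed.

Lemma card_QR : #|` QR N| = #|squares|.
Proof.
rewrite QR_squares card_imfset; last exact: unit_repr_inj.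
by rewrite /= cardE.
Qed.

End Squares.

(** * The indexing of quadratic residues and its circuit size *)

Lemma QR_lt N z : z \in QR N -> z < N.
Proof.
rewrite in_fset inE => /andP [zZ _]; move: zZ.
by rewrite in_fset inE mem_iota => /andP []; lia.
Qed.

Lemma card_QR_leq N : #|` QR N| <= N.
Proof.
rewrite -[leqRHS](size_iota 0); apply: uniq_leq_size (fset_uniq _) _ => z.
by move/QR_lt; rewrite mem_iota.
Qed.

Lemma greedy_indexing N L : 0 < N ->
  let M := #|` QR N| in let value i := greedy (mulmod N) L i (1 %% N) in
  (forall i, i \in bracket M -> value i \in QR N) ->
  (forall z, z \in QR N -> exists2 i, i \in bracket M & value i = z) ->
  all (fun p => 0 < p.1 <= N) L -> size L <= 2 * bit_length N + 1 ->
  {D : encoding (QR N) | indexing D /\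
    exists C : circuit (in_width D) (out_width (QR N)),
      circuit_size C <= 72 * (bit_length N + 2) ^ 3 /\ computes C}.
Proof.
move=> N0 M value valQR surj Lw sizeL.
pose dec (i : bracket M) : QR N := [` valQR _ (fsvalP i)]%fset.
have decP (s : QR N) : exists i, dec i = s.
  have [i iM iE] := surj _ (fsvalP s).
  by exists [` iM]%fset; apply: val_inj.
exists (Encoding decP); split=> //.
have Nw : N < 2 ^ bit_length N := ltn_exp2_bit_length N.
(* One digit more than [N] has makes room for [2 N]. *)
have [||||| C [sizeC CP]] := @greedy_circuit _ (Encoding decP) (bit_length N).+1 N L N0.
- by rewrite expnS; lia.
- by rewrite expnS /=; have := card_QR_leq N; rewrite -/M; lia.
- exact: QR_lt.
- by apply: sub_all Lw => p /andP [-> le]; rewrite expnS; lia.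
- by [].
exists C; split=> //; apply: leq_trans sizeC _.
by move: (bit_length N) sizeL => l; rewrite !expnS !expn0; nia.
Qed.

Lemma QR_indexing N : 0 < N ->
  {D : encoding (QR N) | indexing D /\
    exists C : circuit (in_width D) (out_width (QR N)),
      circuit_size C <= 72 * (bit_length N + 2) ^ 3 /\ computes C}.
Proof.
case: N => [|[|n]] // _.
  (* For [N = 1] there are no residues, and the empty list decodes an empty domain. *)
  have QR1 z : z \in QR 1 = false.
    by apply/negP; rewrite in_fset inE => /andP []; rewrite in_fset inE.
  have card0 : #|` QR 1| = 0.
    by apply/eqP; rewrite cardfs_eq0; apply/eqP/fsetP => z; rewrite QR1 in_fset0.
  apply: (@greedy_indexing 1 [::]) => // [i|z].
    by rewrite card0 mem_bracket; case: i.
  by rewrite QR1.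
have [L [Lw LG sizeL surj]] := abelian_greedy (squares_abelian n).
(* The leading pair [(1, 1)] turns indices in [{1, ..., M}] into [{0, ..., M - 1}]. *)
pose L1 := (1, 1) :: [seq (p.1, unit_repr p.2) | p <- L].
have value i : greedy (mulmod n.+2) L1 i.+1 (1 %% n.+2) =
    unit_repr (greedy mulg L i 1%g).
  by rewrite greedy_unit_repr /= subn1.
have MN := card_QR_leq n.+2.
apply: (@greedy_indexing n.+2 L1) => //.
- move=> [|i]; rewrite mem_bracket // => /andP [_ iM].
  rewrite value QR_squares in_imfset //=.
  by apply: (greedy_in_group (G := squares_group n)) => //; apply: group1.
- move=> z; rewrite {1}QR_squares => /imfsetP [u uG ->].
  have [i iM iu] := surj u uG; exists i.+1; last by rewrite value iu.
  by rewrite mem_bracket card_QR.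
- rewrite /= all_map; apply: sub_all Lw => p /= /andP [-> le].
  by apply: leq_trans le _; rewrite -card_QR.
(* Apart from the leading pair, [2 ^ size L <= #|QR N| ^ 2 <= N ^ 2], which is at most
   [2 ^ (2 * bit_length N)]. *)
- rewrite /= size_map addn1 ltnS -(leq_exp2l (m := 2)) // mulnC expnM.
  apply: leq_trans sizeL _; rewrite leq_exp2r // -card_QR.
  exact: leq_trans MN (ltnW (ltn_exp2_bit_length _)).
Qed.

(** * Injectivity of binary names and the polynomial bound *)

Lemma eq_mod_exp2 w m m' :
  (forall j, j < w -> odd (m %/ 2 ^ j) = odd (m' %/ 2 ^ j)) -> m = m' %[mod 2 ^ w].
Proof.
elim: w => [|w IH] mm'; first by rewrite !modn1.
by rewrite !modn_exp2S mm' // IH // => j jw; apply/mm'/ltnW.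
Qed.

(** Equal strings have equal lengths, and a number is determined by its digits up to its bit
    length. *)
Lemma binary_inj : injective binary.
Proof.
move=> m m' mm'.
have ww : bit_length m = bit_length m' by have := congr1 size mm'; rewrite !size_tuple.
rewrite -[m](modn_small (ltn_exp2_bit_length m)).
rewrite -[RHS](modn_small (ltn_exp2_bit_length m')) -ww.
apply: eq_mod_exp2 => j jw; have jw' := jw; rewrite ww in jw'.
have := congr1 (nth false ^~ j) mm'.
rewrite -(tnth_nth false (bits _ m) (Ordinal jw)).
rewrite -(tnth_nth false (bits _ m') (Ordinal jw')).
by rewrite !tnth_mktuple.
Qed.

Theorem theorem1 :
  exists D : ensemble (fun N : posnat => binary (sval N))
                      (fun N : posnat => QR (sval N)),
    (forall N : posnat, indexing (D N)) /\ decodable_by_poly_size_circuits D.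
Proof.
have name_inj : injective (fun N : posnat => binary (sval N)).
  by move=> N N' /binary_inj; apply: val_inj.
exists (Ensemble name_inj (fun N : posnat => sval (QR_indexing (svalP N)))).
split=> [N|]; first by case: (svalP (QR_indexing (svalP N))).
(* The name of [N] has length [bit_length N], so this is the bound of [QR_indexing] as a
   polynomial. *)
exists (72%:P * ('X + 2%:P) ^+ 3)%R => N.
have [_ [C [sizeC CP]]] := svalP (QR_indexing (svalP N)).
exists C; split=> //; apply: leq_trans sizeC _.
by rewrite hornerM horner_exp hornerD !hornerC hornerX size_tuple.
Qed.
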